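(* For any real $\alpha\ge3$, the matrix $$\mathbf{M}=\begin{pmatrix}1&\alpha&-1\\-1&1&\alpha\\ \alpha&-1&1\end{pmatrix}$$ is sufficient, and $\hat\kappa^\star(\mathbf{M})\ge\frac{\alpha-3}{8}$.
   Context: For $u,v\in\mathbb{R}^n$, $u\circ v$ is the coordinate-wise product; vector inequalities are coordinate-wise. A matrix $\mathbf{M}\in\mathbb{R}^{n\times n}$ is column sufficient if, for all $x\in\mathbb{R}^n$, $x\circ(\mathbf{M}x)\le\mathbf{0}$ implies $x\circ(\mathbf{M}x)=\mathbf{0}$; row sufficient if $\mathbf{M}^\top$ is column sufficient; sufficient if it is both. For $x\in\mathbb{R}^n$ let $\mathcal{I}^+_{\mathbf{M}}(x)=\{i\in[n] : x_i(\mathbf{M}x)_i>0\}$. The handicap number is $$\hat\kappa(\mathbf{M})=\min\Big\{\kappa\ge 0 \;:\; x^\top \mathbf{M}x+4\kappa\sum_{i\in\mathcal{I}^+_{\mathbf{M}}(x)}x_i(\mathbf{M}x)_i\ge 0\ \ \forall x\in\mathbb{R}^n\Big\},$$ with value $\infty$ if no such $\kappa$ exists. The optimized handicap number is $\hat\kappa^\star(\mathbf{M})=\inf\{\hat\kappa(\mathbf{D}\mathbf{M}) : \mathbf{D}\in\mathbb{R}^{n\times n}\text{ diagonal with positive diagonal entries}\}$. *)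

(* Defs.v *)
From mathcomp Require Import all_boot all_order all_algebra.
From mathcomp Require Import boolp classical_sets reals constructive_ereal ereal.

Set Implicit Arguments.
Unset Strict Implicit.
Unset Printing Implicit Defensive.

Import Order.TTheory GRing.Theory Num.Theory.

Local Open Scope classical_set_scope.
Local Open Scope ring_scope.

Section Sufficiency.
Variables (R : realType) (n : nat).
Implicit Types (M : 'M[R]_n) (x u v : 'cV[R]_n).

Definition coordwise_mul u v : 'cV[R]_n := map2_mx *%R u v.

Definition coordwise_le u v : Prop := forall i, u i 0 <= v i 0.

Definition column_sufficient M : Prop :=
  forall x, coordwise_le (coordwise_mul x (M *m x)) 0 ->
    coordwise_mul x (M *m x) = 0.

Definition row_sufficient M : Prop := column_sufficient M^T.

Definition sufficient M : Prop := column_sufficient M /\ row_sufficient M.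

Definition Iplus M x : {set 'I_n} := [set i | 0 < x i 0 * (M *m x) i 0]%SET.

Definition handicap_set M : set R :=
  [set k | 0 <= k /\ forall x,
    0 <= (x^T *m M *m x) 0 0
         + 4 * k * \sum_(i in Iplus M x) x i 0 * (M *m x) i 0].

(* The infimum in \bar R is +oo on the empty set, and is otherwise a minimum:
   see handicap_attained. *)
Definition handicap M : \bar R := ereal_inf (EFin @` handicap_set M).

Definition optimized_handicap M : \bar R :=
  ereal_inf [set handicap (D *m M) | D in
    [set D : 'M[R]_n | is_diag_mx D /\ forall i, 0 < D i i]].

Lemma handicap_attained M : handicap_set M !=set0 ->
  (EFin @` handicap_set M) (handicap M).
Proof.
move=> [k0 Mk0].
have lb0 : lbound (handicap_set M) 0 by move=> k [].
have hi : has_inf (handicap_set M) by split; [exists k0 | exists 0].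
have -> : handicap M = (inf (handicap_set M))%:E.
  by apply: ereal_inf_EFin; [exists 0 | exists k0].
exists (inf (handicap_set M)) => //; split.
  by apply: lb_le_inf => //; exists k0.
move=> x.
set q := (x^T *m M *m x) 0 0.
set S := \sum_(i in _) _.
have S0 : 0 <= S by apply: sumr_ge0 => i; rewrite inE => /ltW.
have [S_eq0|S_neq0] := eqVneq S 0.
  by have [_ /(_ x)] := Mk0; rewrite -/q -/S S_eq0 !mulr0.
have S4 : 0 < 4 * S by rewrite mulr_gt0 // lt0r S_neq0.
have : - q / (4 * S) <= inf (handicap_set M).
  apply: lb_le_inf; first by exists k0.
  move=> k [_ /(_ x)]; rewrite -/q -/S => Hk.
  by rewrite ler_pdivrMr // -subr_ge0 opprK addrC mulrCA mulrA.
by rewrite ler_pdivrMr // -subr_ge0 opprK addrC mulrCA mulrA.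
Qed.

End Sufficiency.

Definition Malpha (R : realType) (a : R) : 'M[R]_3 :=
  \matrix_(i < 3, j < 3)
    (nth [::] [:: [:: 1;  a; -1];
                  [:: -1; 1;  a];
                  [:: a; -1;  1]] i)`_j.

(* Main.v *)
Require Import Defs.
From mathcomp Require Import all_boot all_order all_algebra.
From mathcomp Require Import boolp classical_sets reals constructive_ereal ereal.
From mathcomp Require Import ring lra.

(** The matrix M is a P-matrix, which gives sufficiency.  The sign structure
    makes this visible by hand ([alpha_system_trivial]): if x has all its
    coordinates of one sign, the products x_i (M x)_i add up to at least the
    sum of the x_i^2; otherwise exactly one coordinate differs in sign from the
    two others, and one row of the system becomes a sum of nonnegative terms,
    which kills a variable, after which the remaining ones vanish in turn.
    Exchanging the first two coordinates conjugates M to its transpose, so the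
    same scalar statement covers row sufficiency.

    For the lower bound, testing a handicap of a matrix N on a vector e_i - e_j
    yields an inequality that involves only the principal submatrix of N on
    {i, j} ([handicap_ge_pair]).  Let D have diagonal d, and let i + 1 denote
    the cyclic successor of i.  For N = D M and j = i + 1 the inequality is
    d_i (alpha - 1) <= 2 (1 + 4 k) d_(i+1).  As d cannot increase strictly all
    the way around the cycle, d_(i+1) <= d_i for some i, and there the scaling
    drops out, leaving alpha - 1 <= 2 (1 + 4 k). *)

Set Implicit Arguments.
Unset Strict Implicit.
Unset Printing Implicit Defensive.

Import Order.TTheory GRing.Theory Num.Theory.
Local Open Scope ring_scope.

(** One cyclic position of the mixed sign case: the first row is then a sum of
    three nonnegative terms. *)
Lemma alpha_system_mixed_sign (R : realFieldType) (a x y z : R) :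
  0 <= a -> 0 <= x * y -> x * z <= 0 -> y * z <= 0 ->
  x * (x + a * y - z) <= 0 -> y * (y + a * z - x) <= 0 ->
  z * (z + a * x - y) <= 0 -> [/\ x = 0, y = 0 & z = 0].
Proof.
move=> a0 xy xz yz hx hy hz.
have axy := mulr_ge0 a0 xy.
have x0 : x = 0.
  apply/eqP; rewrite -sqrf_eq0 eq_le sqr_ge0 andbT.
  by move: hx; rewrite expr2; nra.
rewrite {}x0 in hx hy hz xy xz axy *.
have z0 : z = 0.
  apply/eqP; rewrite -sqrf_eq0 eq_le sqr_ge0 andbT.
  by move: hz; rewrite expr2; nra.
rewrite {}z0 in hy *; split=> //.
by apply/eqP; rewrite -sqrf_eq0 eq_le sqr_ge0 andbT expr2; nra.
Qed.

(** This is the P-matrix property of M: no nonzero vector has its sign reversed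
    by M. *)
Lemma alpha_system_trivial (R : realFieldType) (a x y z : R) : 1 <= a ->
  x * (x + a * y - z) <= 0 -> y * (y + a * z - x) <= 0 ->
  z * (z + a * x - y) <= 0 -> [/\ x = 0, y = 0 & z = 0].
Proof.
move=> a1 hx hy hz; have a0 : 0 <= a by lra.
have same : 0 <= x * y -> 0 <= y * z -> 0 <= x * z -> [/\ x = 0, y = 0 & z = 0].
  move=> xy yz xz.
  have h : 0 <= (a - 1) * (x * y + y * z + x * z).
    by rewrite mulr_ge0 ?subr_ge0 ?addr_ge0.
  have sx := sqr_ge0 x; have sy := sqr_ge0 y; have sz := sqr_ge0 z.
  have hs : x ^+ 2 + y ^+ 2 + z ^+ 2 <= 0 by nra.
  by split; apply/eqP; rewrite -sqrf_eq0 eq_le sqr_ge0 andbT; lra.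
have [x0|x0] := leP 0 x; have [y0|y0] := leP 0 y; have [z0|z0] := leP 0 z.
- by apply: same; nra.
- by apply: (@alpha_system_mixed_sign _ a) => //; nra.
- by case: (@alpha_system_mixed_sign _ a z x y) => //; nra.
- by case: (@alpha_system_mixed_sign _ a y z x) => //; nra.
- by case: (@alpha_system_mixed_sign _ a y z x) => //; nra.
- by case: (@alpha_system_mixed_sign _ a z x y) => //; nra.
- by apply: (@alpha_system_mixed_sign _ a) => //; nra.
- by apply: same; nra.
Qed.

Lemma forall_ord3 (P : 'I_3 -> Prop) : P 0 -> P 1 -> P 2 -> forall i, P i.
Proof.
move=> P0 P1 P2 [[|[|[|//]]] lti].
- by congr P: P0; apply: val_inj.
- by congr P: P1; apply: val_inj.
- by congr P: P2; apply: val_inj.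
Qed.

Lemma coordwise_mul_mulmx3 (R : realType) (M : 'M[R]_3) (x : 'cV[R]_3) i :
  coordwise_mul x (M *m x) i 0 =
  x i 0 * (M i 0 * x 0 0 + M i 1 * x 1 0 + M i 2 * x 2 0).
Proof.
rewrite !mxE !big_ord_recl big_ord0 addr0 addrA.
by congr (_ * (M _ _ * x _ _ + M _ _ * x _ _ + M _ _ * x _ _)); apply: val_inj.
Qed.

Lemma Malpha_column_sufficient (R : realType) (a : R) :
  1 <= a -> column_sufficient (Malpha a).
Proof.
move=> a1 x hx.
have := (hx 0, hx 1, hx 2).
rewrite !coordwise_mul_mulmx3 !mxE /= => -[[h0 h1] h2].
have [||||e0 e1 e2] := @alpha_system_trivial _ a (x 0 0) (x 1 0) (x 2 0) => //.
- by lra.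
- by lra.
- by lra.
apply/matrixP => i j; rewrite ord1 coordwise_mul_mulmx3.
by rewrite e0 e1 e2 !mulr0 !addr0 mulr0 [RHS]mxE.
Qed.

Lemma Malpha_row_sufficient (R : realType) (a : R) :
  1 <= a -> row_sufficient (Malpha a).
Proof.
move=> a1 x hx.
have := (hx 0, hx 1, hx 2).
rewrite !coordwise_mul_mulmx3 !mxE /= => -[[h0 h1] h2].
(* Exchanging the first two coordinates turns the transposed system into the
   original one. *)
have [||||e1 e0 e2] := @alpha_system_trivial _ a (x 1 0) (x 0 0) (x 2 0) => //.
- by lra.
- by lra.
- by lra.
apply/matrixP => i j; rewrite ord1 coordwise_mul_mulmx3.
by rewrite e0 e1 e2 !mulr0 !addr0 mulr0 [RHS]mxE.
Qed.

(** The test vector is e_i - e_j, whose products x_l (N x)_l vanish outside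
    {i, j}; the hypotheses say that the one at i is nonpositive and the one
    at j is positive, so that only j is weighted by 1 + 4 k. *)
Lemma handicap_ge_pair (R : realType) n (N : 'M[R]_n) (i j : 'I_n) (k : R) :
  i != j -> N i i <= N i j -> N j i < N j j -> handicap_set N k ->
  N i j - N i i <= (1 + 4 * k) * (N j j - N j i).
Proof.
move=> ij hi hj [_ hk].
pose x : 'cV[R]_n := delta_mx i 0 - delta_mx j 0.
have xE l : x l 0 = (l == i)%:R - (l == j)%:R.
  by rewrite !mxE eqxx !andbT.
have NxE l : (N *m x) l 0 = N l i - N l j.
  by rewrite mulmxBr -!colE !mxE.
have pi : x i 0 * (N *m x) i 0 = N i i - N i j.
  by rewrite xE NxE eqxx (negPf ij) subr0 mul1r.
have pj : x j 0 * (N *m x) j 0 = N j j - N j i.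
  by rewrite xE NxE eqxx eq_sym (negPf ij) sub0r mulN1r opprB.
have p0 l : l != i -> l != j -> x l 0 * (N *m x) l 0 = 0.
  by move=> /negPf li /negPf lj; rewrite xE li lj subr0 mul0r.
have quadE : (x^T *m N *m x) 0 0 = (N i i - N i j) + (N j j - N j i).
  rewrite -mulmxA mxE (eq_bigr (fun l => x l 0 * (N *m x) l 0)); last first.
    by move=> l _; rewrite [x^T _ _]mxE.
  rewrite (bigD1 i) //= (bigD1 j) /=; last by rewrite eq_sym.
  by rewrite pi pj big1 ?addr0 // => l /andP[li lj]; apply: p0.
have -> : (1 + 4 * k) * (N j j - N j i) =
    N j j - N j i + 4 * k * (N j j - N j i) by ring.
have IplusE : Iplus N x = [set j]%SET.
  apply/setP => l; rewrite !inE; have [->|lj] := eqVneq l j.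
    by rewrite pj subr_gt0.
  have [->|li] := eqVneq l i; last by rewrite p0 // ltxx.
  by rewrite pi subr_gt0 ltNge hi.
have := hk x; rewrite IplusE big_set1 pj quadE.
by lra.
Qed.

Lemma diag_mulmx_entry (R : nzRingType) m n (D : 'M[R]_m) (A : 'M[R]_(m, n)) i j :
  is_diag_mx D -> (D *m A) i j = D i i * A i j.
Proof. by case/diag_mxP => d ->; rewrite mul_diag_mx !mxE eqxx. Qed.

Lemma exists_cyclic_descent (R : realDomainType) (d : 'I_3 -> R) :
  exists i, d (i + 1) <= d i.
Proof.
have e2 : (2 : 'I_3) = 1 + 1 by apply: val_inj.
have e0 : (0 : 'I_3) = 2 + 1 by apply: val_inj.
have [h|h01] := leP (d 1) (d 0); first by exists 0; rewrite add0r.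
have [h|h12] := leP (d 2) (d 1); first by exists 1; rewrite -e2.
by exists 2; rewrite -e0 ltW // (lt_trans h01).
Qed.

(** The principal submatrices on cyclically consecutive indices are all
    equal, because M is circulant. *)
Lemma Malpha_cyclic_pair (R : realType) (a : R) (i : 'I_3) :
  [/\ Malpha a i i = 1, Malpha a i (i + 1) = a & Malpha a (i + 1) i = -1].
Proof. by elim/forall_ord3: i; rewrite !mxE. Qed.

Lemma handicap_diag_Malpha_ge (R : realType) (a k : R) (D : 'M[R]_3) :
  1 <= a -> is_diag_mx D -> (forall i, 0 < D i i) ->
  handicap_set (D *m Malpha a) k -> (a - 3) / 8 <= k.
Proof.
move=> a1 Ddiag D0 hk.
have [i hi] := exists_cyclic_descent (fun i => D i i).
have k0 : 0 <= k by case: hk.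
have neq_succ : i != i + 1 by elim/forall_ord3: (i).
have [Mii Mij Mji] := Malpha_cyclic_pair a i.
have [Mjj _ _] := Malpha_cyclic_pair a (i + 1).
have Di := D0 i; have Dj := D0 (i + 1).
have main : D i i * a - D i i * 1 <=
    (1 + 4 * k) * (D (i + 1) (i + 1) * 1 - D (i + 1) (i + 1) * -1).
  have := handicap_ge_pair neq_succ _ _ hk.
  rewrite !diag_mulmx_entry // Mii Mij Mji Mjj; apply.
  - by rewrite ler_pM2l.
  - by rewrite ltr_pM2l //; lra.
have scaled : D i i * (a - 1) <= D i i * (2 * (1 + 4 * k)).
  have : 0 <= (D i i - D (i + 1) (i + 1)) * (2 * (1 + 4 * k)).
    by rewrite mulr_ge0 ?subr_ge0 //; lra.
  by lra.
by move: scaled; rewrite ler_pM2l //; lra.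
Qed.

Theorem proposition1p6 (R : realType) (alpha : R) (halpha : 3 <= alpha) :
  sufficient (Malpha alpha) /\
  (((alpha - 3) / 8)%:E <= optimized_handicap (Malpha alpha))%E.
Proof.
have a1 : 1 <= alpha by lra.
split.
  by split; [apply: Malpha_column_sufficient | apply: Malpha_row_sufficient].
apply: le_ereal_inf_tmp => _ [D [Ddiag D0] <-].
apply: le_ereal_inf_tmp => _ [k hk <-].
by rewrite lee_fin; apply: handicap_diag_Malpha_ge hk.
Qed.
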